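(* Let $X$ be a real Banach space whose modulus of smoothness satisfies $\rho(u,X)\le\gamma u^q$ for all $u\ge 0$, where $\gamma>0$ and $1<q\le2$; put $\mu(u)=\gamma u^q$ and $p=\frac{q}{q-1}$. Let $b\in(0,1]$ and let $\tau=\{t_k\}_{k=1}^\infty$ be a nonincreasing weakness sequence, $1\ge t_1\ge t_2\ge\dots>0$. Let $m\ge1$ be an integer and let $0\le\alpha\le\frac{t_m(1-b)}{1+t_m(1-b)}$. Then $$\gamma_m^{\tau,b,\mu}(\alpha,X)\le\left(1+c\sum_{k=1}^m t_k^p\right)^{-\alpha/p},\qquad c=(1-b)\left(\frac{b}{2\gamma}\right)^{\frac1{q-1}},$$ and the same inequality holds for $\gamma_m^{\tau,b,\mu}(\alpha,X)^*$. Here $$\gamma_m^{\tau,b,\mu}(\alpha,X)=\sup_{\mathcal{D}}\ \sup_{f\in A_1(\mathcal{D}),\,f\neq0}\ \sup_{G_m^{\tau,b,\mu}(f,\mathcal{D})}\frac{\|f-G_m^{\tau,b,\mu}(f,\mathcal{D})\|}{\|f\|^{1-\alpha}\,\|f\|_{A_1(\mathcal{D})}^{\alpha}},$$ the suprema being over all symmetric dictionaries $\mathcal{D}$ in $X$, all nonzero $f\in A_1(\mathcal{D})$ and all realizations of the Dual Greedy Algorithm DGA$(\tau,b,\mu)$, and $\gamma_m^{\tau,b,\mu}(\alpha,X)^*$ is defined in the same way with the modified algorithm DGA$(\tau,b,\mu)^*$ in place of DGA$(\tau,b,\mu)$.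
   Context: For a real Banach space $X$, the modulus of smoothness is $\rho(u)=\rho(u,X)=\sup_{\|x\|=\|y\|=1}\left(\frac12(\|x+uy\|+\|x-uy\|)-1\right)$. A (symmetric) dictionary is a set $\mathcal{D}\subset X$ with $\|g\|=1$ for all $g\in\mathcal{D}$, with closed linear span equal to $X$, and such that $g\in\mathcal{D}$ implies $-g\in\mathcal{D}$. $A_1(\mathcal{D})$ is the closure in $X$ of the convex hull of $\mathcal{D}$, and $\|f\|_{A_1(\mathcal{D})}=\inf\{M>0: f/M\in A_1(\mathcal{D})\}$. For nonzero $f\in X$, $F_f$ denotes a norming functional: $\|F_f\|=1$, $F_f(f)=\|f\|$ (unique here, since $X$ is uniformly smooth), and $r_{\mathcal{D}}(f)=\sup_{F_f}\sup_{g\in\mathcal{D}}F_f(g)$. Dual Greedy Algorithm DGA$(\tau,b,\mu)$: put $f_0=f$, $G_0=0$. For $m\ge1$, if $f_{m-1}=0$, set $f_j=0$ for $j\ge m$ and stop. If $f_{m-1}\ne0$: (1) take any $\varphi_m\in\mathcal{D}$ with $F_{f_{m-1}}(\varphi_m)\ge t_m r_{\mathcal{D}}(f_{m-1})$ (if $t_m=1$ it is assumed that such a maximizer exists); (2) choose $c_m>0$ from the equation $\|f_{m-1}\|\,\mu(c_m/\|f_{m-1}\|)=\frac{t_mb}{2}c_m r_{\mathcal{D}}(f_{m-1})$; (3) set $f_m=f_{m-1}-c_m\varphi_m$ and $G_m=G_m^{\tau,b,\mu}(f,\mathcal{D})=G_{m-1}+c_m\varphi_m$. Thus $f_m=f-G_m$.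 The modification DGA$(\tau,b,\mu)^*$ is the same algorithm except that in step (2) $c_m>0$ is found from $\|f_{m-1}\|\,\mu(c_m/\|f_{m-1}\|)=\frac b2 c_m F_{f_{m-1}}(\varphi_m)$. A realization is any outcome of admissible choices. *)

(* Defs.v *)
From HB Require Import structures.
From mathcomp Require Import all_boot all_order all_algebra.
From mathcomp Require Import all_classical all_reals all_analysis.
Set Implicit Arguments.
Unset Strict Implicit.
Unset Printing Implicit Defensive.
Import Order.TTheory GRing.Theory Num.Theory.
Import numFieldNormedType.Exports.
Local Open Scope classical_set_scope.
Local Open Scope ring_scope.

Section Banach.
Context {R : realType} (X : completeNormedModType R).

Definition unit_sphere : set X := [set x | `|x| = 1].

Definition modulus_of_smoothness (u : R) : R :=
  sup [set 2^-1 * (`|x + u *: y| + `|x - u *: y|) - 1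
      | x in unit_sphere & y in unit_sphere].

Definition dual_norm (F : X -> R^o) : R :=
  sup [set `|F x| | x in [set x : X | `|x| <= 1]].

(* When the set under [sup] is unbounded, [sup] is 0 by convention, so
   [dual_norm F = 1] does say that [F] is bounded with norm 1. *)
Definition norming_functional (f : X) (F : {linear X -> R^o}) : Prop :=
  [/\ continuous F, dual_norm F = 1 & F f = `|f|].

Definition linear_span (D : set X) : set X :=
  [set x | exists (n : nat) (a : 'I_n -> R) (g : 'I_n -> X),
      (forall i, D (g i)) /\ x = \sum_(i < n) a i *: g i].

Definition symmetric_dictionary (D : set X) : Prop :=
  [/\ D `<=` unit_sphere,
      closure (linear_span D) = setT &
      forall g, D g -> D (- g)].

Definition convex_hull (D : set X) : set X :=
  [set x | exists (n : nat) (a : 'I_n -> R) (g : 'I_n -> X),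
      [/\ forall i, 0 <= a i, \sum_(i < n) a i = 1,
          forall i, D (g i) & x = \sum_(i < n) a i *: g i]].

Definition A1 (D : set X) : set X := closure (convex_hull D).

Definition A1_norm (D : set X) (f : X) : R :=
  inf [set M : R | 0 < M /\ A1 D (M^-1 *: f)].

Definition r_dict (D : set X) (f : X) : R :=
  sup [set r | exists (F : {linear X -> R^o}) (g : X),
      [/\ norming_functional f F, D g & r = F g]].

End Banach.

Section DualGreedy.
Context {R : realType} {X : completeNormedModType R}.
Variables (t : nat -> R) (b : R) (mu : R -> R) (D : set X).

(* The rule selecting c_k from the current residual [h] = f_(k-1), the chosen
   norming functional [F] of [h] and the chosen element [phi] = phi_k. *)
Definition coef_rule :=
  nat -> X -> {linear X -> R^o} -> X -> R -> Prop.

Definition DGA_coef : coef_rule := fun k h F phi c =>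
  `|h| * mu (c / `|h|) = t k * b / 2 * c * r_dict D h.

Definition DGAstar_coef : coef_rule := fun k h F phi c =>
  `|h| * mu (c / `|h|) = b / 2 * c * F phi.

(* [h], [G] are f_(k-1), G_(k-1) and [h'], [G'] are f_k, G_k. *)
Definition greedy_step (rule : coef_rule) (k : nat) (h G h' G' : X) : Prop :=
  (h = 0 -> h' = 0 /\ G' = G) /\
  (h <> 0 -> exists (F : {linear X -> R^o}) (phi : X) (c : R),
     [/\ norming_functional h F,
         D phi /\ t k * r_dict D h <= F phi,
         0 < c /\ rule k h F phi c,
         h' = h - c *: phi &
         G' = G + c *: phi]).

(* The first [m] iterations of the algorithm started at [f]; the weakness
   sequence is indexed from 1, so [t 0] is never used. *)
Definition realization (rule : coef_rule) (m : nat) (f : X)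
    (f_ G_ : nat -> X) : Prop :=
  [/\ f_ 0%N = f, G_ 0%N = 0 &
      forall k, (k < m)%N ->
        greedy_step rule k.+1 (f_ k) (G_ k) (f_ k.+1) (G_ k.+1)].

End DualGreedy.

Section Rate.
Context {R : realType} (X : completeNormedModType R).

Definition greedy_rate (rule : set X -> @coef_rule R X) (t : nat -> R)
    (m : nat) (alpha : R) : \bar R :=
  ereal_sup [set e | exists (D : set X) (f : X) (f_ G_ : nat -> X),
    [/\ symmetric_dictionary D,
        A1 D f /\ f <> 0,
        realization t D (rule D) m f f_ G_ &
        e = (`|f - G_ m| / (`|f| `^ (1 - alpha) * A1_norm D f `^ alpha))%:E]].

Definition gamma_DGA (t : nat -> R) (b : R) (mu : R -> R) (m : nat)
    (alpha : R) : \bar R :=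
  greedy_rate (DGA_coef t b mu) t m alpha.

Definition gamma_DGAstar (t : nat -> R) (b : R) (mu : R -> R) (m : nat)
    (alpha : R) : \bar R :=
  greedy_rate (fun=> DGAstar_coef b mu) t m alpha.

End Rate.

(* Main.v *)
(* Put B_k = ||f||_{A_1(D)} + c_1 + ... + c_k and beta = alpha / (1 - alpha), so
   that beta <= t_k (1 - b) for k <= m. Since f_k lies in B_k A_1(D), one has
   r_D(f_k) >= ||f_k|| / B_k. Smoothness and the choice of c_k make the norm
   decrease by at least the factor 1 - (1 - b) t_k c_k / B_(k-1), so
   ||f_k|| B_k^beta does not increase; solving for c_k, they also make it decrease
   by the factor 1 - c t_k^p (||f_(k-1)|| / B_(k-1))^p, so that
   (||f_m|| / B_m)^p (1 + c sum t_k^p) <= 1. A geometric mean of the two bounds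
   eliminates B_m. *)
Require Import Defs.
From mathcomp Require Import all_boot all_order all_algebra.
From mathcomp Require Import all_classical all_reals all_analysis.
From mathcomp Require Import ring lra zify.
Import Order.TTheory GRing.Theory Num.Theory.
Import numFieldNormedType.Exports.
Local Open Scope classical_set_scope.
Local Open Scope ring_scope.

(** * Real-variable inequalities for powers *)

Section Scalars.
Context {R : realType}.
Implicit Types (N B T p q s u v x y beta : R).

(* [(1 - z)(1 + y / B) `^ beta <= 1] for [z = beta * (y / B)], since
   [1 - z <= expR (- z)] and [ln (1 + y / B) <= y / B]. *)
Lemma powR_weight_step N N' B y beta : 0 <= N -> 0 < B -> 0 <= y ->
  0 <= beta -> N' <= N * (1 - beta * (y / B)) ->
  N' * (B + y) `^ beta <= N * B `^ beta.
Proof.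
move=> N0 B0 y0 beta0 N'N.
have yB0 : 0 <= y / B by rewrite divr_ge0// ltW.
have -> : B + y = B * (1 + y / B) by rewrite mulrDr mulr1 mulrC divfK ?gt_eqF.
rewrite powRM ?addr_ge0 ?(ltW B0)// mulrCA [N * _]mulrC.
rewrite ler_wpM2l ?powR_ge0//.
have yB1 : 0 < 1 + y / B by rewrite ltr_pwDl.
rewrite [_ `^ _]/powR gt_eqF//.
apply: (le_trans (ler_wpM2r (expR_ge0 _) N'N)).
rewrite -mulrA ler_piMr//.
apply: (@le_trans _ _ (expR (- (beta * (y / B))) * expR (beta * (y / B)))); last first.
  by rewrite -expRD addNr expR0.
apply: (@le_trans _ _ (expR (- (beta * (y / B))) * expR (beta * ln (1 + y / B)))).
  by rewrite ler_wpM2r ?expR_ge0// expR_ge1Dx.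
rewrite ler_wpM2l ?expR_ge0// ler_expR ler_wpM2l//.
by rewrite le_ln1Dx// (lt_le_trans _ yB0)// ltrN10.
Qed.

(** With [A = (N / B)^p] the hypotheses give [A T <= 1] and, because [(1 - x)^p <= 1 - x], also
    [N'^p <= (1 - s A) A B^p]. Then [(1 - s A) A (T + s) <= (1 - s A) (1 + s A) <= 1]. *)
Lemma powR_decay_step N N' B B' T p s x : 1 <= p -> 0 <= N -> 0 < N' ->
  0 < B -> B <= B' -> 0 <= s -> N' <= N * (1 - x) ->
  s * (N / B) `^ p <= x -> N `^ p * T <= B `^ p ->
  N' `^ p * (T + s) <= B' `^ p.
Proof.
move=> p1 N0 N'0 B0 BB' s0 N'N sx NT.
have p0 : 0 <= p by rewrite (le_trans ler01).
have {}N0 : 0 < N.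
  by rewrite lt_neqAle N0 andbT; apply: contraTneq N'N => <-; rewrite mul0r -ltNge.
have x1 : 0 < 1 - x by rewrite -(pmulr_rgt0 _ N0) (lt_le_trans N'0).
set A := (N / B) `^ p in sx.
have A0 : 0 <= A by exact: powR_ge0.
have NA : N `^ p = A * B `^ p.
  by rewrite /A -powRM ?divr_ge0 ?(ltW B0) ?(ltW N0)// divfK ?gt_eqF.
have Bp0 : 0 < B `^ p by exact: powR_gt0.
have AT : A * T <= 1.
  by rewrite -(ler_pM2r Bp0) mul1r -mulrA [T * _]mulrC mulrA -NA.
have N'p : N' `^ p <= (1 - s * A) * A * B `^ p.
  apply: (@le_trans _ _ ((1 - x) * N `^ p)); last first.
    by rewrite NA mulrA ler_wpM2r ?(ltW Bp0)// ler_wpM2r// lerB.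
  apply: (le_trans _ (@ge1r_powRZ _ (1 - x) N p _ (ltW N0) p1)); last first.
    by rewrite x1 lerBlDr lerDl (le_trans _ sx)// mulr_ge0.
  by rewrite ge0_ler_powR ?nnegrE ?mulr_ge0 ?(ltW x1) ?(ltW N0) ?(ltW N'0)// mulrC.
have BpB' : B `^ p <= B' `^ p.
  by rewrite ge0_ler_powR ?nnegrE ?(ltW B0)// (le_trans (ltW B0)).
apply: le_trans BpB'.
have [Ts0|Ts0] := leP 0 (T + s); last first.
  by rewrite (le_trans _ (ltW Bp0))// mulr_ge0_le0 ?powR_ge0// ltW.
apply: (le_trans (ler_wpM2r Ts0 N'p)).
have sA1 : 0 <= 1 - s * A by lra.
have : (1 - s * A) * (A * (T + s)) <= 1.
  have h : A * (T + s) <= 1 + s * A by nra.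
  by apply: (le_trans (ler_wpM2l sA1 h)); nra.
by move=> h; rewrite mulrAC ler_piMl ?(ltW Bp0)//; lra.
Qed.

(* The weights [1 - alpha] and [alpha] of the two hypotheses eliminate [B]. *)
Lemma powR_interpolate N n M B T p alpha : 0 < p -> 0 <= alpha < 1 ->
  0 < N -> 0 < n -> 0 < M -> 0 < B -> 0 < T ->
  N * B `^ (alpha / (1 - alpha)) <= n * M `^ (alpha / (1 - alpha)) ->
  N `^ p * T <= B `^ p ->
  N / (n `^ (1 - alpha) * M `^ alpha) <= T `^ (- alpha / p).
Proof.
move=> p0 /andP[al0 al1] N0 n0 M0 B0 T0 h1 h2.
have a1 : 0 < 1 - alpha by rewrite subr_gt0.
rewrite ler_pdivrMr ?mulr_gt0 ?powR_gt0//.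
(* Logarithms make everything linear: the goal is [h1] times [1 - alpha] plus [h2] times
   [alpha / p]. *)
rewrite -ler_ln ?posrE ?mulr_gt0 ?powR_gt0//.
move: h1 h2.
rewrite -ler_ln ?posrE ?mulr_gt0 ?powR_gt0// => h1.
rewrite -ler_ln ?posrE ?mulr_gt0 ?powR_gt0// => h2.
move: h1 h2; rewrite !lnM ?posrE ?mulr_gt0 ?powR_gt0// !ln_powR => h1 h2.
have {}h1 : (1 - alpha) * ln N + alpha * ln B
    <= (1 - alpha) * ln n + alpha * ln M.
  have := ler_wpM2l (ltW a1) h1; rewrite !mulrDr !mulrA.
  by rewrite [(1 - alpha) * alpha]mulrC mulfK ?gt_eqF.
have {}h2 : alpha * ln N + alpha / p * ln T <= alpha * ln B.
  have := ler_wpM2l (divr_ge0 al0 (ltW p0)) h2.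
  by rewrite mulrDr !mulrA divfK ?gt_eqF.
rewrite mulNr [- _ * _]mulNr; lra.
Qed.

(** Here [u] is the step length relative to the norm of the residual. Solving for it gives
    [u^(q - 1) = b v / (2 gamma)], the source of the constant [c] and the exponent [p] of the
    rate. *)
Lemma powR_coef_product gamma q b u v : 0 < gamma -> 1 < q -> 0 < b ->
  0 < u -> gamma * u `^ q = b / 2 * u * v ->
  u * v = (b / (2 * gamma)) `^ (1 / (q - 1)) * v `^ (q / (q - 1)).
Proof.
move=> gamma0 q1 b0 u0 e.
have q0 : 0 < q by rewrite (lt_trans ltr01).
have d0 : q - 1 != 0 by rewrite subr_eq0 gt_eqF.
have {}e : u `^ (q - 1) = b / (2 * gamma) * v.
  have : u * u `^ (q - 1) * gamma = u * (b / (2 * gamma) * v) * gamma.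
    rewrite mulr_powRB1 ?(ltW u0)// mulrC e.
    by field; rewrite gt_eqF.
  by move=> /(mulIf (lt0r_neq0 gamma0)) /(mulfI (lt0r_neq0 u0)).
have b20 : 0 < b / (2 * gamma) by rewrite divr_gt0// mulr_gt0.
have v0 : 0 < v by rewrite -(pmulr_rgt0 _ b20) -e powR_gt0.
have -> : u = (b / (2 * gamma) * v) `^ (1 / (q - 1)).
  by rewrite -e -powRrM mul1r divff// powRr1// ltW.
rewrite powRM ?(ltW b20) ?(ltW v0)// -mulrA; congr (_ * _).
rewrite mulrC -{1}(powRr1 (ltW v0)) -powRD; last by rewrite (gt_eqF v0) implybT.
by congr (_ `^ _); field.
Qed.

End Scalars.

(** * Norming functionals, smoothness and the hull [A1] *)

Section Functionals.
Context {R : realType} {X : completeNormedModType R}.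
Implicit Types (f h x : X) (D : set X) (F : {linear X -> R^o}).

Lemma norming_functional_le f F x : norming_functional f F -> F x <= `|x|.
Proof.
move=> [_ F1 _].
have [->|x0] := eqVneq x 0; first by rewrite linear0 normr0.
have nx : 0 < `|x| by rewrite normr_gt0.
rewrite /dual_norm in F1; set S := (X in sup X) in F1.
have hS : has_sup S.
  (* Without a supremum, [sup S] would default to 0 instead of 1. *)
  by apply: contrapT => /sup_out e; move: F1; rewrite e => /eqP; rewrite eq_sym oner_eq0.
have : `|F (`|x|^-1 *: x)| <= 1.
  rewrite -F1; apply: (sup_upper_bound hS); exists (`|x|^-1 *: x) => //=.
  by rewrite normrZ normfV normr_id mulVf ?gt_eqF.
rewrite linearZ/= => /(le_trans (ler_norm _)).
by rewrite -[X in X <= _]/(`|x|^-1 * F x) ler_pdivrMl// mulr1.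
Qed.

Lemma norming_functional_le_r_dict D f F x : D `<=` @unit_sphere R X ->
  norming_functional f F -> D x -> F x <= r_dict D f.
Proof.
move=> D1 nF Dx; apply: ub_le_sup; last by exists F, x.
exists 1 => _ [F' [g [nF' Dg ->]]].
by rewrite -(D1 _ Dg) (norming_functional_le _ _ _ nF').
Qed.

Lemma le_modulus_of_smoothness (u : R) x y : `|x| = 1 -> `|y| = 1 ->
  2^-1 * (`|x + u *: y| + `|x - u *: y|) - 1 <= modulus_of_smoothness X u.
Proof.
move=> x1 y1; apply: ub_le_sup; last by exists x => //; exists y.
(* The triangle inequality bounds the set, so its [sup] is a true supremum. *)
exists `|u| => _ [x' x'1 [y' y'1 <-]].
have h1 := ler_normD x' (u *: y'); have h2 := ler_normB x' (u *: y').
rewrite normrZ x'1 y'1 in h1 h2; lra.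
Qed.

(* Smoothness bounds [|h - a phi| + |h + a phi|] from above, and [F] bounds
   [|h + a phi|] from below. *)
Lemma norm_sub_le_smoothness h phi F (a : R) : h <> 0 -> `|phi| = 1 ->
  norming_functional h F ->
  `|h - a *: phi|
    <= `|h| + 2 * (`|h| * modulus_of_smoothness X (a / `|h|)) - a * F phi.
Proof.
move=> /eqP h0 phi1 nF.
have nh : 0 < `|h| by rewrite normr_gt0.
have Fh : `|h| + a * F phi <= `|h + a *: phi|.
  have := norming_functional_le _ _ (h + a *: phi) nF.
  by case: nF => _ _ <-; rewrite linearD linearZ.
have hn1 : `| `|h|^-1 *: h| = 1 by rewrite normrZ normfV normr_id mulVf ?gt_eqF.
have := le_modulus_of_smoothness (a / `|h|) _ _ hn1 phi1.
rewrite -(ler_pM2l nh).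
(* Rescaling by the norm of [h]; [e = 1] and [e = -1] give the two terms. *)
have sc (e : R) : `|h| * `| `|h|^-1 *: h + (e * (a / `|h|)) *: phi| = `|h + (e * a) *: phi|.
  rewrite -{1}(normr_id h) -normrZ scalerDr !scalerA divff ?gt_eqF// scale1r.
  by congr (`|_ + _ *: _|); field; rewrite gt_eqF.
have := sc 1; have := sc (-1); rewrite !mul1r !mulN1r !scaleNr => e1 e2.
rewrite mulrBr mulrCA mulrDr e1 e2; lra.
Qed.

(** The half-space where [F <= r] is closed and convex, so it contains [A1 D] once it contains
    [D]. *)
Lemma A1_le D F (r : R) x : continuous F -> (forall g, D g -> F g <= r) ->
  A1 D x -> F x <= r.
Proof.
move=> cF Dr.
have cl : closed (F @^-1` [set y : R^o | y <= r]).
  by apply: preimage_closed; [move=> y _; exact: cF | exact: closed_le].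
move: cl => /closure_id cl.
suff : A1 D `<=` F @^-1` [set y : R^o | y <= r] by apply.
rewrite cl; apply: closureS => _ [n [a [g [a0 a1 Dg ->]]]] /=.
rewrite linear_sum/= -[r]mul1r -a1 mulr_suml ler_sum// => i _.
by rewrite linearZ ler_wpM2l// Dr.
Qed.

Lemma A1_norm_le D F (r : R) f : continuous F -> (forall g, D g -> F g <= r) ->
  0 <= r -> A1 D f -> F f <= A1_norm D f * r.
Proof.
move=> cF Dr r0 Df.
have S0 : [set M : R | 0 < M /\ A1 D (M^-1 *: f)] !=set0.
  by exists 1; split => //=; rewrite invr1 scale1r.
have FM (M : R) : 0 < M -> A1 D (M^-1 *: f) -> F f <= M * r.
  move=> M0 /(A1_le _ _ _ _ cF Dr); rewrite linearZ/=.
  by rewrite -[X in X <= _]/(M^-1 * F f) ler_pdivrMl.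
(* Passing to the infimum over [M] divides by [r], so [r = 0] is separate. *)
have [e|rn0] := eqVneq r 0.
  by have [M [/= M0 /(FM _ M0)]] := S0; rewrite e !mulr0.
have {}r0 : 0 < r by rewrite lt_neqAle eq_sym rn0.
rewrite -ler_pdivrMr//; apply: lb_le_inf => // M [M0 /(FM _ M0)].
by rewrite ler_pdivrMr.
Qed.

End Functionals.

(** * Invariants of the greedy iteration *)

Section GreedyRate.
Context {R : realType} {X : completeNormedModType R}.
Context {gamma q b alpha : R} {t : nat -> R} {m : nat}.
Let mu := fun u : R => gamma * u `^ q.
Let p := q / (q - 1).
Let c := (1 - b) * (b / (2 * gamma)) `^ (1 / (q - 1)).
Let beta := alpha / (1 - alpha).
Hypotheses (gamma_gt0 : 0 < gamma) (q_gt1 : 1 < q).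
Hypothesis smooth : forall u : R, 0 <= u -> modulus_of_smoothness X u <= mu u.
Hypotheses (b_gt0 : 0 < b) (b_le1 : b <= 1).
Hypothesis t_gt0 : forall k : nat, (1 <= k)%N -> 0 < t k.
Hypothesis t_noninc : forall k : nat, (1 <= k)%N -> t k.+1 <= t k.
Hypothesis m_ge1 : (1 <= m)%N.
Hypothesis alpha_ge0 : 0 <= alpha.
Hypothesis alpha_le : alpha <= t m * (1 - b) / (1 + t m * (1 - b)).

Variables (D : set X) (rule : @coef_rule R X).
Hypothesis dictD : symmetric_dictionary D.
(* The common form of the two coefficient rules: [v] is [t_k r_D(h)] for
   DGA and [F phi] for the modified algorithm. *)
Hypothesis ruleP : forall k h F phi a, rule k h F phi a ->
  t k * r_dict D h <= F phi ->
  exists v, [/\ t k * r_dict D h <= v, v <= F phi &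
                `|h| * mu (a / `|h|) = b / 2 * a * v].

Let sphereD : D `<=` @unit_sphere R X. Proof. by case: dictD. Qed.

Let p_ge1 : 1 <= p.
Proof. by rewrite ler_pdivlMr ?subr_gt0//; lra. Qed.

Let c_ge0 : 0 <= c.
Proof. by rewrite mulr_ge0 ?subr_ge0 ?powR_ge0. Qed.

Let t_ge k : (1 <= k <= m)%N -> t m <= t k.
Proof.
move=> /andP[k1]; elim: m => [|n IH]; first by rewrite leqn0 => /eqP ->.
rewrite leq_eqVlt => /predU1P[-> //|]; rewrite ltnS => kn.
by rewrite (le_trans _ (IH kn))// t_noninc// (leq_trans k1).
Qed.

Let alpha_lt1 : alpha < 1.
Proof.
apply: (le_lt_trans alpha_le).
have w0 : 0 <= t m * (1 - b) by rewrite mulr_ge0 ?subr_ge0// ltW// t_gt0.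
by rewrite ltr_pdivrMr ?mul1r; lra.
Qed.

Let beta_ge0 : 0 <= beta.
Proof. by rewrite divr_ge0// subr_ge0 ltW. Qed.

(** For [w = t m * (1 - b)], the bound [alpha <= w / (1 + w)] amounts to
    [alpha / (1 - alpha) <= w]. *)
Let beta_le k : (1 <= k <= m)%N -> beta <= t k * (1 - b).
Proof.
move=> km; apply: (@le_trans _ _ (t m * (1 - b))); last first.
  by rewrite ler_wpM2r ?subr_ge0// t_ge.
have w0 : 0 <= t m * (1 - b) by rewrite mulr_ge0 ?subr_ge0// ltW// t_gt0.
rewrite ler_pdivrMr ?subr_gt0//.
move: alpha_le; rewrite ler_pdivlMr; last by rewrite ltr_pwDl.
by rewrite mulrDr mulr1 mulrBr mulr1 [alpha * _]mulrC; lra.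
Qed.

(** By symmetry of [D], [r_dict D h] bounds both [F phi] and its opposite. *)
Let r_dict_ge0 h F phi : norming_functional h F -> D phi -> 0 <= r_dict D h.
Proof.
move=> nF Dphi; have [_ _ Dsym] := dictD.
have := norming_functional_le_r_dict _ _ _ _ sphereD nF Dphi.
have := norming_functional_le_r_dict _ _ _ _ sphereD nF (Dsym _ Dphi).
by rewrite linearN => h1 h2; have := lerD h1 h2; rewrite addNr; lra.
Qed.

(* [greedy_control k h f B]: the scaled set [B A_1(D)] contains [h] in the weak
   sense tested by functionals, while [B] is controlled by the norm of [h]. *)
Let greedy_control (k : nat) (f h : X) (B : R) :=
  [/\ 0 < B,
      forall (F : {linear X -> R^o}) (r : R), continuous F -> 0 <= r ->
        (forall g, D g -> F g <= r) -> F h <= B * r,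
      `|h| * B `^ beta <= `|f| * A1_norm D f `^ beta &
      `|h| `^ p * (1 + c * \sum_(1 <= j < k.+1) t j `^ p) <= B `^ p].

Let greedy_control_step k f h G h' G' B : (k < m)%N -> h <> 0 -> h' <> 0 ->
  greedy_step t D rule k.+1 h G h' G' -> greedy_control k f h B ->
  exists B', greedy_control k.+1 f h' B'.
Proof.
move=> km h0 h'0 [_ /(_ h0)] [F [phi [a [nF [Dphi tF] [a0 ra] h'E _]]]].
move=> [B0 hB w1 w2].
have [v [tv vF e]] := ruleP _ _ _ _ _ ra tF.
have N0 : 0 < `|h| by rewrite normr_gt0; exact/eqP.
set u := a / `|h| in e; set r := r_dict D h in tF tv.
have u0 : 0 < u by rewrite divr_gt0.
have r0 : 0 <= r := r_dict_ge0 _ _ _ nF Dphi.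
have Fr g : D g -> F g <= r := norming_functional_le_r_dict _ _ _ _ sphereD nF.
have aE : a = `|h| * u by rewrite mulrC divfK ?gt_eqF.
have e' : mu u = b / 2 * u * v.
  by apply: (mulfI (lt0r_neq0 N0)); rewrite e aE; ring.
have [cF _ FhE] := nF.
(* The invariant is tested on the norming functional of [h] itself. *)
have NB : `|h| / B <= r by rewrite ler_pdivrMr// mulrC -FhE hB.
have tk0 : 0 < t k.+1 by exact: t_gt0.
have NB0 : 0 <= `|h| / B by rewrite divr_ge0// ltW.
have tNv : t k.+1 * (`|h| / B) <= v by rewrite (le_trans _ tv)// ler_pM2l.
have v0 : 0 <= v by rewrite (le_trans _ tNv)// mulr_ge0// ltW.
(* Smoothness costs at most [b * a * v] while the functional gains at least [a * v], a net decrease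
   of [(1 - b) * a * v]. *)
have N'N : `|h'| <= `|h| * (1 - (1 - b) * (u * v)).
  rewrite h'E; apply: (le_trans (norm_sub_le_smoothness _ _ _ a h0 (sphereD _ Dphi) nF)).
  have s1 : `|h| * modulus_of_smoothness X u <= b / 2 * a * v.
    by rewrite -e ler_wpM2l// smooth// ltW.
  have s2 : a * v <= a * F phi by rewrite ler_pM2l.
  have -> : `|h| * (1 - (1 - b) * (u * v)) = `|h| - (1 - b) * (a * v).
    by rewrite aE; ring.
  rewrite -/u; lra.
(* Subtracting [a *: phi] costs [a] more copies of [A1 D], since [- phi] lies in [D]. *)
exists (B + a); split.
- by rewrite addr_gt0.
- move=> F' r' cF' r'0 Dr'; rewrite h'E linearB linearZ/= mulrDl.
  have [_ _ Dsym] := dictD.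
  have := Dr' _ (Dsym _ Dphi); rewrite linearN => /(ler_wpM2l (ltW a0)).
  have := hB _ _ cF' r'0 Dr'; rewrite -[a *: F' phi]/(a * F' phi) mulrN.
  exact: lerD.
(* It suffices that [beta * (a / B) <= (1 - b) * (u * v)], which follows from [beta_le] and
   [tNv]. *)
- apply: (le_trans _ w1); apply: powR_weight_step => //; first exact: ltW.
  apply: (le_trans N'N); rewrite ler_wpM2l// lerB//.
  have -> : beta * (a / B) = u * (beta * (`|h| / B)) by rewrite aE; ring.
  rewrite [leRHS]mulrCA ler_wpM2l ?(ltW u0)//.
  apply: (@le_trans _ _ ((1 - b) * (t k.+1 * (`|h| / B)))).
    by rewrite [leRHS]mulrA ler_wpM2r// [leRHS]mulrC beta_le.
  by rewrite ler_wpM2l// subr_ge0.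
- rewrite big_nat_recr//= [c * _]mulrDr addrA.
  apply: (powR_decay_step _ _ _ _ _ _ _ _ _ _ _ _ _ _ N'N _ w2) => //.
  + by rewrite normr_gt0; exact/eqP.
  + by rewrite lerDl ltW.
  + by rewrite mulr_ge0// powR_ge0.
  (* The relative decrease [(1 - b) * (u * v)] equals [c v^p], and [tNv] bounds [v] from below. *)
  + rewrite (powR_coef_product _ _ _ _ _ gamma_gt0 q_gt1 b_gt0 u0 e') mulrA -/c -/p.
    rewrite -mulrA ler_wpM2l// -powRM ?(ltW tk0)//.
    by rewrite ge0_ler_powR ?nnegrE ?(le_trans _ p_ge1)// mulr_ge0// ltW.
Qed.

Lemma realization_ratio_le f f_ G_ : A1 D f -> f <> 0 ->
  realization t D rule m f f_ G_ ->
  `|f - G_ m| / (`|f| `^ (1 - alpha) * A1_norm D f `^ alpha)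
    <= (1 + c * \sum_(1 <= k < m.+1) t k `^ p) `^ (- alpha / p).
Proof.
move=> Df f0 [f00 G00 step].
have n0 : 0 < `|f| by rewrite normr_gt0; exact/eqP.
have fG k : (k <= m)%N -> f - G_ k = f_ k.
  elim: k => [|k IH] km; first by rewrite f00 G00 subr0.
  have [s0 s1] := step _ km; have {}IH := IH (ltnW km).
  have [h0|/eqP h0] := eqVneq (f_ k) 0.
    by have [-> ->] := s0 h0; rewrite IH.
  by have [F [phi [a [_ _ _ -> ->]]]] := s1 h0; rewrite opprD addrA IH.
rewrite fG//.
have [->|/eqP fm0] := eqVneq (f_ m) 0; first by rewrite normr0 mul0r powR_ge0.
(* A zero residual would stay zero up to index [m]. *)
have nz k : (k <= m)%N -> f_ k <> 0.
  move=> km fk0; apply: fm0; rewrite -(subnKC km).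
  have : (m - k <= m - k)%N by [].
  elim: {1 3}(m - k)%N => [|i IH] im; first by rewrite addn0.
  rewrite addnS; have [s0 _] := step (k + i)%N ltac:(lia).
  by have [] := s0 (IH (ltnW im)).
(* The first step supplies a norming functional of [f], which is at most 1 on [D]. *)
have nM : `|f| <= A1_norm D f.
  have [_ s1] := step 0%N m_ge1.
  have [F [phi [a [nF [Dphi _] _ _ _]]]] := s1 (nz 0%N (leq0n _)).
  rewrite f00 in nF; have [cF _ <-] := nF.
  rewrite -[leRHS]mulr1; apply: A1_norm_le => // g Dg.
  by rewrite -(sphereD _ Dg) (norming_functional_le _ _ _ nF).
have M0 : 0 < A1_norm D f := lt_le_trans n0 nM.
have p0 : 0 < p := lt_le_trans ltr01 p_ge1.
have [B [B0 _ w1 w2]] : exists B, greedy_control m f (f_ m) B.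
  have : (m <= m)%N by [].
  elim: {1 3 4}m => [|k IH] km; last first.
    have [B hB] := IH (ltnW km).
    exact: greedy_control_step (nz k (ltnW km)) (nz _ km) (step _ km) hB.
  (* At index 0 the sum is empty, and the last clause reduces to [nM]. *)
  exists (A1_norm D f); rewrite f00; split => //.
    by move=> F r cF r0 Dr; exact: A1_norm_le.
  rewrite big_geq// mulr0 addr0 mulr1.
  by rewrite ge0_ler_powR ?nnegrE ?(ltW p0) ?(ltW M0).
apply: powR_interpolate w1 w2 => //.
- by rewrite alpha_ge0.
- by rewrite normr_gt0; exact/eqP.
- by rewrite ltr_pwDl// mulr_ge0// sumr_ge0// => i _; exact: powR_ge0.
Qed.

End GreedyRate.

Theorem theorem3p2 (R : realType) (X : completeNormedModType R)
    (gamma q b alpha : R) (t : nat -> R) (m : nat)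
    (gamma_gt0 : 0 < gamma) (q_gt1 : 1 < q) (q_le2 : q <= 2)
    (smooth : forall u : R, 0 <= u ->
       modulus_of_smoothness X u <= gamma * u `^ q)
    (b_gt0 : 0 < b) (b_le1 : b <= 1)
    (t1_le1 : t 1%N <= 1)
    (t_gt0 : forall k : nat, (1 <= k)%N -> 0 < t k)
    (t_noninc : forall k : nat, (1 <= k)%N -> t k.+1 <= t k)
    (m_ge1 : (1 <= m)%N)
    (alpha_ge0 : 0 <= alpha)
    (alpha_le : alpha <= t m * (1 - b) / (1 + t m * (1 - b))) :
  let mu := fun u : R => gamma * u `^ q in
  let p := q / (q - 1) in
  let c := (1 - b) * (b / (2 * gamma)) `^ (1 / (q - 1)) in
  let bound := (1 + c * \sum_(1 <= k < m.+1) t k `^ p) `^ (- alpha / p) in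
  (gamma_DGA X t b mu m alpha <= bound%:E)%E /\
  (gamma_DGAstar X t b mu m alpha <= bound%:E)%E.
Proof.
move=> mu p c bound; split; apply: ge_ereal_sup => _ [D [f [f_ [G_ [dictD [Df f0] rz ->]]]]];
  rewrite lee_fin; apply: realization_ratio_le rz => // k h F phi a; move=> rl tF.
- by exists (t k * r_dict D h); split => //; rewrite rl; ring.
- by exists (F phi); split.
Qed.
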